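(* Let $\mathbf S=\bigcup_{n\ge1}\mathbf S_n$ be the (disjoint) union of all symmetric groups, with the right cross-order product $\odot_r$ defined for $\sigma\in\mathbf S_m$, $\mu\in\mathbf S_n$, $t=\mathrm{lcm}(m,n)$ by $$\sigma\odot_r\mu:=\psi^m_t(\sigma)\circ\psi^n_t(\mu)\in\mathbf S_t .$$ Then $(\mathbf S,\odot_r,\mathbf e)$ is a hyper group, where the identity set is $\mathbf e=\{e_n=\mathrm{Id}_n\in\mathbf S_n: n\ge 1\}$, indexed by the lattice of positive integers ordered by divisibility.
   Context: $\mathbf S_n$ is the group of permutations of $\{1,\dots,n\}$ under composition $\circ$. For $m\mid n$, $n=km$, the right embedding $\psi^m_n:\mathbf S_m\to\mathbf S_n$ is defined by $\psi^m_n(\sigma)((s-1)m+i):=(s-1)m+\sigma(i)$ for $1\le s\le k$, $1\le i\le m$ (equivalently, the permutation matrix of $\psi^m_n(\sigma)$ is $I_k\otimes P_\sigma$, where $P_\sigma$ is the permutation matrix of $\sigma$ with $i$-th column the $\sigma(i)$-th standard basis vector). Hyper group: Let $(G,* )$ be a semigroup. A subset $\mathbf e\subset G$ is an identity set if (i) $g*e=e*g$ for all $g\in G$, $e\in\mathbf e$; (ii) $\mathbf e=\{e_\lambda:\lambda\in\Lambda\}$ is indexed without repetition by a lattice $(\Lambda,\le)$ and $e_\lambda*e_\mu=e_{\lambda\vee\mu}$; (iii) for each $g\in G$ there is a unique $e_g=e_{\lambda_g}\in\mathbf e$ such that for all $\lambda\in\Lambda$: $e_\lambda*g=g$ if and only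 if $\lambda\le\lambda_g$. A hyper group $(G,*,\mathbf e)$ is a semigroup with an identity set such that for each $g\in G$ there is $g^{-1}\in G$ with $g*g^{-1}=g^{-1}*g=e_g$. *)

(* Defs.v *)
From HB Require Import structures.
From mathcomp Require Import all_boot all_order all_fingroup.

Set Implicit Arguments.
Unset Strict Implicit.
Unset Printing Implicit Defensive.

Import Order.Theory.

(* An identity set is given together with its indexing by the lattice L, as
   the family e : L -> G; the subset of G is the range of e. *)
Section HyperGroup.

Variables (G : Type) (op : G -> G -> G).
Variables (d : Order.disp_t) (L : latticeType d) (e : L -> G).

Definition identity_index (g : G) (lg : L) : Prop :=
  forall l : L, op (e l) g = g <-> (l <= lg)%O.

Record identity_set : Prop := IdentitySet {
  identity_set_comm : forall (g : G) (l : L), op g (e l) = op (e l) g;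
  identity_set_inj : injective e;
  identity_set_join : forall l m : L, op (e l) (e m) = e (l `|` m)%O;
  identity_set_index : forall g : G, exists! lg : L, identity_index g lg
}.

(* In the last field, e lg is the identity e_g of g: lg is unique by
   identity_set_index. *)
Record hyper_group : Prop := HyperGroup {
  hyper_group_assoc : associative op;
  hyper_group_identity : identity_set;
  hyper_group_inv : forall (g : G) (lg : L), identity_index g lg ->
    exists h : G, op g h = e lg /\ op h g = e lg
}.

End HyperGroup.

(* The lattice of positive integers under divisibility, as a sublattice of
   natdvd; the restriction matters since natdvd also contains 0, its top. *)
Definition posn : {pred natdvd} := fun n => (0 < (n : nat))%N.

Lemma posn_meet : {in posn &, forall m n : natdvd, (m `&` n)%O \in posn}.
Proof. by move=> m n; rewrite !unfold_in => m0 n0; rewrite gcdn_gt0 m0. Qed.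

Lemma posn_join : {in posn &, forall m n : natdvd, (m `|` n)%O \in posn}.
Proof. by move=> m n; rewrite !unfold_in => m0 n0; rewrite lcmn_gt0 m0 n0. Qed.

HB.instance Definition _ :=
  Order.isLatticeClosed.Build _ natdvd posn posn_meet posn_join.

Record posdvd := PosDvd { posdvd_val : natdvd; _ : posdvd_val \in posn }.

HB.instance Definition _ := [isSub for posdvd_val].
HB.instance Definition _ := [Choice of posdvd by <:].
HB.instance Definition _ := [SubChoice_isSubLattice of posdvd by <:
  with Order.dvd_display].

Definition nat_of_posdvd (n : posdvd) : nat := posdvd_val n.
Coercion nat_of_posdvd : posdvd >-> nat.

Lemma posdvd_gt0 (n : posdvd) : 0 < n.
Proof. by case: n. Qed.

Lemma pos_lcm_subproof (m n : posdvd) : (lcmn m n : natdvd) \in posn.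
Proof. by rewrite unfold_in lcmn_gt0 !posdvd_gt0. Qed.

Definition pos_lcm (m n : posdvd) : posdvd := PosDvd (pos_lcm_subproof m n).

Lemma leEposdvd (m n : posdvd) : (m <= n)%O = (m %| n).
Proof. by []. Qed.

Lemma joinEposdvd (m n : posdvd) : (m `|` n)%O = pos_lcm m n.
Proof. exact: val_inj. Qed.

(* With 0-based indices, x = (s-1) m + (i-1) is sent to
   (s-1) m + (sigma(i)-1), where s-1 = x %/ m and i-1 = x %% m. *)
Section RightEmbedding.

Variables (m n : posdvd) (mn : m %| n) (sigma : 'S_m).

Definition modn_ord (x : nat) : 'I_m := Ordinal (ltn_pmod x (posdvd_gt0 m)).

Lemma psi_subproof (x : 'I_n) : x %/ m * m + sigma (modn_ord x) < n.
Proof.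
have lt_s : x %/ m < n %/ m by rewrite ltn_divRL // (leq_ltn_trans (leq_divM _ _)).
rewrite -[X in _ < X](divnK mn); apply: leq_trans (leq_mul lt_s (leqnn m)).
by rewrite mulSn addnC ltn_add2r.
Qed.

Definition psi_fun (x : 'I_n) : 'I_n := Ordinal (psi_subproof x).

Lemma psi_fun_inj : injective psi_fun.
Proof.
move=> x y /(congr1 val) /= eq_xy; have m_gt0 := posdvd_gt0 m.
have eq_div : x %/ m = y %/ m.
  by move/(congr1 (divn^~ m)): eq_xy; rewrite !divnMDl // !(divn_small (ltn_ord _)) !addn0.
move/eqP: eq_xy; rewrite eq_div eqn_add2l => /eqP/val_inj/perm_inj/(congr1 val) /= eq_mod.
by apply: val_inj; rewrite /= (divn_eq x m) eq_div eq_mod -divn_eq.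
Qed.

Definition psi : 'S_n := perm psi_fun_inj.

Lemma psiE (s : nat) (i : 'I_m) (x : 'I_n) :
  x = s * m + i :> nat -> psi x = s * m + sigma i :> nat.
Proof.
move=> def_x; rewrite permE /= def_x divnMDl ?posdvd_gt0 // divn_small // addn0.
by congr (_ + sigma _); apply: val_inj; rewrite /= modnMDl modn_small.
Qed.

End RightEmbedding.

Definition symU := {n : posdvd & 'S_n}.

Definition SymU (n : posdvd) (sigma : 'S_n) : symU :=
  existT (fun k : posdvd => 'S_k) n sigma.

(* The group product of 'S_n applies its left factor first, so the
   composition sigma \o mu is the product mu * sigma. *)
Definition perm_comp (n : nat) (sigma mu : 'S_n) : 'S_n := (mu * sigma)%g.

Lemma perm_compE (n : nat) (sigma mu : 'S_n) :
  perm_comp sigma mu =1 sigma \o mu.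
Proof. exact: permM. Qed.

Definition odot_r (a b : symU) : symU :=
  let: existT m sigma := a in
  let: existT n mu := b in
  SymU (perm_comp (psi (dvdn_lcml m n : m %| pos_lcm m n) sigma)
                  (psi (dvdn_lcmr m n : n %| pos_lcm m n) mu)).

Definition idS (n : posdvd) : symU := SymU (1%g : 'S_n).

(* Main.v *)
Require Import Defs.
From mathcomp Require Import all_boot all_order all_fingroup.

(** A permutation sigma of order m acts on the whole of nat by permuting every
    block of m consecutive numbers in the same way; call this periodic map the
    extension of sigma.  The embedding [psi] leaves the extension unchanged
    ([extend_psi]): a block of length n is cut into n / m blocks of length m,
    and [psi] applies sigma on each of them.  Hence the cross-order product
    takes lcms of orders and composes extensions ([extend_odot]).  Since an
    element is determined by its order and its extension ([symU_eq]), the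
    semigroup S embeds in the product of the positive integers under lcm and
    the self-maps of nat under composition.  The identity of order n becomes
    the pair of n and the identity map, so all the hyper group laws reduce to
    facts on lcms: e_l * g = g means that lcm (l, n) = n, where n is the order
    of g, that is, that l divides n; thus e_g is the identity of order n, and
    the inverse of g inside S_n is an inverse with respect to e_g. *)

Import Order.Theory.

Definition order_of (a : symU) : posdvd := tag a.

Definition extend (a : symU) (x : nat) : nat :=
  x %/ order_of a * order_of a + tagged a (modn_ord (order_of a) x).

(** On x < n the extension is sigma itself, so it determines sigma. *)
Lemma symU_eq (a b : symU) :
  order_of a = order_of b -> extend a =1 extend b -> a = b.
Proof.
case: a b => [n s] [n' t] /= eq_n; rewrite /order_of /= in eq_n.
case: n' / eq_n t => t eq_st; congr existT; apply/permP => x; apply: val_inj.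
have mod_x : modn_ord n x = x by apply: val_inj; rewrite /= modn_small.
by have := eq_st x; rewrite /extend /= divn_small // mod_x.
Qed.

Lemma extend_psi (m n : posdvd) (mn : m %| n) (s : 'S_m) :
  extend (SymU (psi mn s)) =1 extend (SymU s).
Proof.
move=> x; have m_gt0 := posdvd_gt0 m; rewrite /extend /= permE /=.
have -> : modn_ord m (x %% n) = modn_ord m x.
  by apply: val_inj; rewrite /= modn_dvdm.
(* What remains is that the m-block of x starts at the same number whether it
   is located from the start of the n-block of x (left) or from 0 (right);
   this holds because n-blocks start at multiples of m. *)
rewrite addnA; congr (_ + _).
have x_eq : x = x %/ n * (n %/ m) * m + x %% n by rewrite -mulnA (divnK mn) -divn_eq.
by rewrite [in RHS]x_eq divnMDl // mulnDl -mulnA (divnK mn).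
Qed.

Lemma extend_comp (n : posdvd) (s t : 'S_n) :
  extend (SymU (perm_comp s t)) =1 extend (SymU s) \o extend (SymU t).
Proof.
move=> x; have n_gt0 := posdvd_gt0 n; rewrite /extend /= permM.
rewrite divnMDl // (divn_small (ltn_ord _)) addn0; congr (_ + s _).
by apply: val_inj; rewrite /= modnMDl modn_small.
Qed.

Lemma extend_id (n : posdvd) : extend (idS n) =1 id.
Proof. by move=> x; rewrite /extend /= perm1 /= -divn_eq. Qed.

Lemma order_odot (a b : symU) :
  order_of (odot_r a b) = (order_of a `|` order_of b)%O.
Proof. by case: a b => [m s] [n t]; rewrite joinEposdvd. Qed.

(** Both factors enter the product through [psi], which preserves extensions,
    and are then composed inside a single symmetric group. *)
Lemma extend_odot (a b : symU) :
  extend (odot_r a b) =1 extend a \o extend b.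
Proof.
by case: a b => [m s] [n t] x; rewrite extend_comp /= !extend_psi.
Qed.

Lemma odot_rA : associative odot_r.
Proof.
move=> a b c; apply: symU_eq => [|x]; first by rewrite !order_odot joinA.
by rewrite !extend_odot /= !extend_odot.
Qed.

Lemma odot_idC (a : symU) (l : posdvd) : odot_r a (idS l) = odot_r (idS l) a.
Proof.
apply: symU_eq => [|x]; first by rewrite !order_odot joinC.
by rewrite !extend_odot /= !extend_id.
Qed.

Lemma odot_id_id (l m : posdvd) : odot_r (idS l) (idS m) = idS (l `|` m)%O.
Proof.
apply: symU_eq => [|x]; first by rewrite order_odot.
by rewrite extend_odot /= !extend_id.
Qed.

Lemma identity_index_order (a : symU) :
  identity_index odot_r idS a (order_of a).
Proof.
move=> l; split=> [/(congr1 order_of) | le_l].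
  by rewrite order_odot => /join_idPr.
apply: symU_eq => [|x]; first by rewrite order_odot; apply/join_idPr.
by rewrite extend_odot /= extend_id.
Qed.

(** An identity index is the largest l with e_l * g = g, hence unique by
    antisymmetry. *)
Lemma identity_index_uniq {G : Type} {op : G -> G -> G} {d : Order.disp_t}
    {L : latticeType d} {e : L -> G} {g : G} {l m : L} :
  identity_index op e g l -> identity_index op e g m -> l = m.
Proof.
by move=> gl gm; apply: le_anti; rewrite (gm l).1 ?(gl m).1 //; [apply/gm | apply/gl].
Qed.

(** The order lcm (n, n) is not convertible to n; comparing extensions avoids
    transporting permutations along the equality. *)
Lemma odot_same_order (n : posdvd) (s t : 'S_n) :
  odot_r (SymU s) (SymU t) = SymU (perm_comp s t).
Proof.
apply: symU_eq => [|x]; first by rewrite order_odot joinxx.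
by rewrite extend_odot extend_comp.
Qed.

Theorem theorem4p17 : hyper_group odot_r idS.
Proof.
split; first exact: odot_rA.
- split; [exact: odot_idC | | exact: odot_id_id |].
    by move=> l m /(congr1 order_of).
  move=> a; exists (order_of a); split; first exact: identity_index_order.
  by move=> l; apply: identity_index_uniq; apply: identity_index_order.
- move=> a l /(identity_index_uniq (identity_index_order a)) <-.
  case: a => n s; exists (SymU s^-1%g).
  by rewrite -/(SymU s) !odot_same_order /perm_comp mulVg mulgV.
Qed.
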